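(* Let $\ast$ be a binary operation on $I=[0,1]$ and let $\Delta$ be a t-norm on $I$. Then the following statements are equivalent: (1) $\widetilde{\Delta}_{\ast}$ satisfies axiom (O6), i.e. $\widetilde{\Delta}_{\ast}$ is closed on $\mathbf{J}=\{\bm{1}_{\{x\}}\mid x\in I\}$; (2) $0\ast 0=0\ast 1=1\ast 0=0$ and $1\ast 1=1$; (3) for all $x_1,x_2\in I$, $\bm{1}_{\{x_1\}}\,\widetilde{\Delta}_{\ast}\,\bm{1}_{\{x_2\}}=\bm{1}_{\{x_1\Delta x_2\}}$.
   Context: Let $I=[0,1]$ and let $\mathbf{M}$ be the set of all maps $I\to I$. For $B\subseteq I$, $\bm{1}_B\in\mathbf{M}$ is the characteristic function of $B$. A t-norm on $I$ is a binary operation $I^2\to I$ that is commutative, associative, increasing (non-decreasing) in each argument, and has neutral element $1$. Given a binary operation $\ast:I^2\to I$ (arbitrary) and a t-norm $\Delta$ on $I$, the binary operation $\widetilde{\Delta}_{\ast}:\mathbf{M}^2\to\mathbf{M}$ is defined by $$(f\,\widetilde{\Delta}_{\ast}\,g)(x)=\sup\{f(y)\ast g(z)\mid y,z\in I,\ y\Delta z=x\},\qquad f,g\in\mathbf{M},\ x\in I.$$ Closed on $\mathbf{J}$ means that $f\,\widetilde{\Delta}_{\ast}\,g\in\mathbf{J}$ for all $f,g\in\mathbf{J}$. *)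

(* Defs.v *)
From mathcomp Require Import all_boot all_order all_algebra.
From mathcomp Require Import interval_inference.
From mathcomp Require Import boolp classical_sets reals.

Set Implicit Arguments.
Unset Strict Implicit.
Unset Printing Implicit Defensive.

Import Order.TTheory GRing.Theory Num.Theory.

Local Open Scope classical_set_scope.
Local Open Scope ring_scope.

(* The interval I = [0, 1] is the type {i01 R}, ordered as a subtype of R, and
   the set M of all maps I -> I is the function type {i01 R} -> {i01 R}. *)

Record is_tnorm (R : realType) (T : {i01 R} -> {i01 R} -> {i01 R}) : Prop :=
  IsTnorm {
    tnormC : commutative T;
    tnormA : associative T;
    tnorm_homol : forall z, {homo T^~ z : x y / x <= y};
    tnorm_homor : forall z, {homo T z : x y / x <= y};
    tnormx1 : right_id 1%:i01 T;
    tnorm1x : left_id 1%:i01 T }.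

Definition char_fun (R : realType) (B : set {i01 R}) : {i01 R} -> {i01 R} :=
  fun x => if x \in B then 1%:i01 else 0%:i01.

Lemma supremums_i01_neq0 (R : realType) (A : set {i01 R}) :
  supremums A !=set0.
Proof.
have [->|/set0P[a Aa]] := eqVneq A set0.
  exists 0%:i01; split => [y []|y _].
  by rewrite -num_le; exact: ge0.
pose B : set R := [set v%:num | v in A].
have ubB : ubound B 1 by move=> _ [v _ <-]; exact: le1.
have Ba : B a%:num by exists a.
have supB : has_sup B by split; [exists a%:num | exists 1].
have s0 : 0 <= sup B.
  by apply: (@le_trans _ _ a%:num); [exact: ge0 | exact: ub_le_sup supB.2 _ Ba].
have s1 : sup B <= 1 by apply: ge_sup ubB; exists a%:num.
exists (Itv01 s0 s1); split => [v Av|v Av]; rewrite -num_le /=.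
  by apply: (ub_le_sup supB.2); exists v.
by apply: ge_sup => [|_ [w Aw <-]]; [exists a%:num | rewrite num_le; exact: Av].
Qed.

(* The supremum is taken in the poset I itself.  The default 0 is the value on
   the empty set only, since every subset of I has a supremum in I
   (supremums_i01_neq0), and for a t-norm the set below is never empty. *)
Definition convolution (R : realType)
    (star T : {i01 R} -> {i01 R} -> {i01 R}) (f g : {i01 R} -> {i01 R}) :
    {i01 R} -> {i01 R} :=
  fun x => supremum 0%:i01
    [set w | exists y z : {i01 R}, T y z = x /\ w = star (f y) (g z)].

Definition closed_on (M : Type) (op : M -> M -> M) (J : set M) : Prop :=
  forall f g, J f -> J g -> J (op f g).

Definition singleton_char_funs (R : realType) : set ({i01 R} -> {i01 R}) :=
  [set char_fun [set x] | x in [set: {i01 R}]].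

(* Main.v *)
Require Import Defs.
From mathcomp Require Import all_boot all_order all_algebra.
From mathcomp Require Import interval_inference.
From mathcomp Require Import boolp classical_sets reals.

Set Implicit Arguments.
Unset Strict Implicit.
Unset Printing Implicit Defensive.

(** The map [convolution star T (char_fun [set x1]) (char_fun [set x2])] is a
    pointwise supremum of products [star u v] with [u] and [v] in {0, 1}, so
    everything is governed by the four corner values of [star].

    If the corners are those of the Boolean conjunction, the only pair
    contributing a 1 is (x1, x2), and it contributes at [T x1 x2]; all other
    products are 0.  This is [convolution_char_fun], from which closure
    follows at once.

    Conversely, assume closure.  Since [1] is neutral, [x] always decomposes as
    [T x 1] and as [T 1 x], so for suitable singletons each of the products
    with at least one factor 0 appears at every nonzero point [x].  The
    convolution of two characteristic functions of singletons is then bounded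
    below by that product at two distinct points, but it vanishes at one of
    them, which forces the product to be 0.  Once these three corners vanish,
    every value of a convolution is at most [star 1 1]; as some value is 1, so
    is [star 1 1]. *)

Import Order.TTheory GRing.Theory Num.Theory.

Local Open Scope classical_set_scope.
Local Open Scope ring_scope.

Lemma i01_ge0 (R : realType) (x : {i01 R}) : 0%:i01 <= x.
Proof. by rewrite -num_le; exact: ge0. Qed.

Lemma i01_le1 (R : realType) (x : {i01 R}) : x <= 1%:i01.
Proof. by rewrite -num_le; exact: le1. Qed.

Lemma i01_oner_neq0 (R : realType) : (1%:i01 : {i01 R}) <> 0%:i01.
Proof. by move=> /(congr1 (fun x : {i01 R} => x%:num)) /eqP; rewrite oner_eq0. Qed.

Lemma i01_inner_point (R : realType) :
  exists2 m : {i01 R}, m <> 0%:i01 & m <> 1%:i01.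
Proof.
have m0 : (0 : R) <= 2^-1 by rewrite invr_ge0.
have m1 : (2^-1 : R) <= 1 by rewrite invf_le1 // ler1n.
exists (Itv01 m0 m1) => /(congr1 (fun x : {i01 R} => x%:num)) /= /eqP.
  by rewrite invr_eq0 pnatr_eq0.
by rewrite invr_eq1 pnatr_eq1.
Qed.

(** The order completeness of [0, 1]: without it, a supremum could fall back on
    its default value [x0] on an inhabited set too. *)
Lemma supremum_i01P (R : realType) (x0 : {i01 R}) (A : set {i01 R}) :
  A !=set0 -> supremums A (supremum x0 A).
Proof.
move=> /set0P A0; rewrite /supremum (negbTE A0).
by case: xgetP => [y _ //|]; have [y Ay] := supremums_i01_neq0 A => /(_ y).
Qed.

Section CharFun.
Context {R : realType}.
Implicit Types x y w : {i01 R}.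

Lemma char_fun1_self x : char_fun [set x] x = 1%:i01.
Proof. by rewrite /char_fun mem_set. Qed.

Lemma char_fun1_neq x y : y <> x -> char_fun [set x] y = 0%:i01.
Proof. by move=> yx; rewrite /char_fun memNset. Qed.

Lemma singleton_char_fun_eq0 (h : {i01 R} -> {i01 R}) x y :
  singleton_char_funs h -> x <> y -> h x = 0%:i01 \/ h y = 0%:i01.
Proof.
move=> [p _ <-] xy; have [xp|xp] := pselect (x = p).
  by right; apply: char_fun1_neq => yp; apply: xy; rewrite xp yp.
by left; exact: char_fun1_neq.
Qed.

(** Since [h] vanishes at [x] or at [y], it cannot dominate a nonzero [w] at
    both. *)
Lemma singleton_char_fun_lower_bound_eq0 (h : {i01 R} -> {i01 R})
    x y w :
  singleton_char_funs h -> x <> y -> w <= h x -> w <= h y -> w = 0%:i01.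
Proof.
move=> Jh xy wx wy; apply: le_anti; rewrite i01_ge0 andbT.
by have [<-|<-] := singleton_char_fun_eq0 Jh xy.
Qed.

End CharFun.

Section Convolution.
Context {R : realType} (star T : {i01 R} -> {i01 R} -> {i01 R}).
Hypothesis hT : is_tnorm T.
Implicit Types (f g : {i01 R} -> {i01 R}) (x y z w : {i01 R}).

(** The set of products is inhabited because [x = T x 1], so the default value
    of the supremum is never taken. *)
Lemma convolution_supremums f g x :
  supremums [set w | exists y z, T y z = x /\ w = star (f y) (g z)]
    (convolution star T f g x).
Proof.
apply: supremum_i01P; exists (star (f x) (g 1%:i01)), x, 1%:i01.
by rewrite (tnormx1 hT).
Qed.

Lemma convolution_ge f g y z :
  star (f y) (g z) <= convolution star T f g (T y z).
Proof. by have [ub _] := convolution_supremums f g (T y z); apply: ub; exists y, z. Qed.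

Lemma convolution_le f g x w :
  (forall y z, T y z = x -> star (f y) (g z) <= w) ->
  convolution star T f g x <= w.
Proof.
move=> le_w; have [_ lub] := convolution_supremums f g x.
by apply: lub => _ [y [z [Tx ->]]]; exact: le_w.
Qed.

Lemma closed_star_corners :
  closed_on (convolution star T) (@singleton_char_funs R) ->
  [/\ star 0%:i01 0%:i01 = 0%:i01, star 0%:i01 1%:i01 = 0%:i01,
      star 1%:i01 0%:i01 = 0%:i01 & star 1%:i01 1%:i01 = 1%:i01].
Proof.
move=> cl; have [m m0 m1] := i01_inner_point R.
have Jconv p q : singleton_char_funs
    (convolution star T (char_fun [set p]) (char_fun [set q])).
  by apply: cl; [exists p | exists q].
have one0 := @i01_oner_neq0 R.
(* Away from 0, [T x 1 = x] puts [star 0 (g 1)] below the convolution of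
   [char_fun [set 0]] with [g = char_fun [set q]]; the choice of [q] makes
   [g 1] either 0 or 1. *)
have left0 q u : char_fun [set q] 1%:i01 = u -> star 0%:i01 u = 0%:i01.
  move=> g1; have low x : x <> 0%:i01 -> star 0%:i01 u <=
      convolution star T (char_fun [set 0%:i01]) (char_fun [set q]) x.
    move=> x0; rewrite -[X in convolution _ _ _ _ X](tnormx1 hT).
    by apply: le_trans _ (convolution_ge _ _ _ _); rewrite g1 (char_fun1_neq x0).
  exact: singleton_char_fun_lower_bound_eq0 (Jconv _ _) m1 (low _ m0) (low _ one0).
have star00 : star 0%:i01 0%:i01 = 0%:i01 := left0 _ _ (char_fun1_neq one0).
have star01 : star 0%:i01 1%:i01 = 0%:i01 := left0 _ _ (char_fun1_self _).
have star10 : star 1%:i01 0%:i01 = 0%:i01.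
  have low x : x <> 0%:i01 -> star 1%:i01 0%:i01 <=
      convolution star T (char_fun [set 1%:i01]) (char_fun [set 0%:i01]) x.
    move=> x0; rewrite -[X in convolution _ _ _ _ X](tnorm1x hT).
    apply: le_trans _ (convolution_ge _ _ _ _).
    by rewrite char_fun1_self (char_fun1_neq x0).
  exact: singleton_char_fun_lower_bound_eq0 (Jconv _ _) m1 (low _ m0) (low _ one0).
split=> //; apply: le_anti; rewrite i01_le1 /=.
(* Any two singletons would do here: the convolution takes the value 1 at
   some [p], while all the products are at most [star 1 1]. *)
have [p _ conv_p] := Jconv 1%:i01 1%:i01.
rewrite -[leLHS](char_fun1_self p) conv_p; apply: convolution_le => y z _.
by rewrite /char_fun; do 2![case: ifP => _];
  rewrite ?star00 ?star01 ?star10 ?i01_ge0.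
Qed.

(** A product [star (f y) (g z)] is 1 for [(y, z) = (x1, x2)] and 0 for every
    other pair, and [(x1, x2)] contributes to the supremum at [T x1 x2] only. *)
Lemma convolution_char_fun x1 x2 :
  [/\ star 0%:i01 0%:i01 = 0%:i01, star 0%:i01 1%:i01 = 0%:i01,
      star 1%:i01 0%:i01 = 0%:i01 & star 1%:i01 1%:i01 = 1%:i01] ->
  convolution star T (char_fun [set x1]) (char_fun [set x2])
    = char_fun [set T x1 x2].
Proof.
move=> [star00 star01 star10 star11]; apply/funext => x.
have [->|xT] := pselect (x = T x1 x2).
  rewrite char_fun1_self; apply: le_anti; rewrite i01_le1 /= -star11.
  by apply: le_trans _ (convolution_ge _ _ _ _); rewrite !char_fun1_self.
rewrite char_fun1_neq //; apply: le_anti; rewrite i01_ge0 andbT.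
apply: convolution_le => y z Tyz.
have [yx|yx] := pselect (y = x1); have [zx|zx] := pselect (z = x2).
- by case: xT; rewrite -Tyz yx zx.
- by rewrite yx char_fun1_self char_fun1_neq // star10.
- by rewrite zx char_fun1_self char_fun1_neq // star01.
- by rewrite !char_fun1_neq // star00.
Qed.

End Convolution.

Theorem theorem10 (R : realType) (star T : {i01 R} -> {i01 R} -> {i01 R})
    (hT : is_tnorm T) :
  [<-> closed_on (convolution star T) (@singleton_char_funs R);
       [/\ star 0%:i01 0%:i01 = 0%:i01, star 0%:i01 1%:i01 = 0%:i01,
           star 1%:i01 0%:i01 = 0%:i01 & star 1%:i01 1%:i01 = 1%:i01];
       forall x1 x2 : {i01 R},
         convolution star T (char_fun [set x1]) (char_fun [set x2])
           = char_fun [set T x1 x2]].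
Proof.
tfae.
- exact: closed_star_corners.
- by move=> corners x1 x2; exact: convolution_char_fun.
- by move=> conv _ _ [x1 _ <-] [x2 _ <-]; rewrite conv; exists (T x1 x2).
Qed.
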